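(* There exists a $4$-interval exchange transformation $T\colon [0,1)\to[0,1)$ that is topologically mixing, i.e. such that for any two nonempty open sets $U,V\subseteq[0,1)$ there exists $N=N_{U,V}$ such that $T^n(U)\cap V\neq\emptyset$ for all $n\ge N$.
   Context: Let $\Delta_{n-1}=\{(l_1,\dots,l_n): l_i>0,\ l_1+\dots+l_n=1\}$. Given $L=(l_1,\dots,l_n)\in\Delta_{n-1}$, let $I_1=[0,l_1)$, $I_2=[l_1,l_1+l_2)$, ..., $I_n=[l_1+\dots+l_{n-1},1)$. Given also a permutation $\pi$ of $\{1,\dots,n\}$, the associated $n$-interval exchange transformation ($n$-IET) is the map $T\colon[0,1)\to[0,1)$ defined by $T(x)=x-\sum_{k<j}l_k+\sum_{\pi(k')<\pi(j)}l_{k'}$ for $x\in I_j$. The interval $[0,1)$ carries its standard topology. *)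

(* Defs.v *)
From HB Require Import structures.
From mathcomp Require Import all_boot all_order all_fingroup all_algebra.
From mathcomp Require Import all_classical all_reals all_analysis.
Set Implicit Arguments.
Unset Strict Implicit.
Unset Printing Implicit Defensive.
Import Order.TTheory GRing.Theory Num.Theory.
Import numFieldNormedType.Exports.
Local Open Scope classical_set_scope.
Local Open Scope ring_scope.

(* Used as a type, this set is the subtype of reals in [0,1[, and its canonical
   topology is the initial topology of the inclusion, i.e. the subspace one
   (see open_unit_ico below). *)
Definition unit_ico (R : realType) : set R := `[0, 1[.
Arguments unit_ico : clear implicits.

Definition open_simplex (R : realType) (n : nat) (l : 'I_n -> R) : Prop :=
  (forall i, 0 < l i) /\ \sum_(i < n) l i = 1.

(* Indices are numbered from 0. *)
Definition iet_piece (R : realType) (n : nat) (l : 'I_n -> R) (j : 'I_n)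
    : set R :=
  `[\sum_(k < n | (k < j)%N) l k, \sum_(k < n | (k <= j)%N) l k[.

(* The pieces partition [0,1[ when l is in the open simplex, so this
   determines T for given l and p. *)
Definition iet_of (R : realType) (n : nat) (l : 'I_n -> R) (p : 'S_n)
    (T : unit_ico R -> unit_ico R) : Prop :=
  forall (j : 'I_n) (x : unit_ico R), iet_piece l j (val x) ->
    val (T x) = val x - \sum_(k < n | (k < j)%N) l k
                      + \sum_(k < n | (p k < p j)%N) l k.

Definition is_iet (R : realType) (n : nat) (T : unit_ico R -> unit_ico R)
    : Prop :=
  exists (l : 'I_n -> R) (p : 'S_n), open_simplex l /\ iet_of l p T.

Definition topologically_mixing (X : topologicalType) (T : X -> X) : Prop :=
  forall U V : set X, open U -> open V -> U !=set0 -> V !=set0 ->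
    exists N : nat, forall n : nat, (N <= n)%N ->
      (iter n T @` U) `&` V !=set0.

Lemma open_unit_ico (R : realType) (U : set (unit_ico R)) :
  open U <-> exists2 W : set R, open W & U = val @^-1` W.
Proof. by split=> [[W oW <-]|[W oW ->]]; exists W. Qed.

(* Main.v *)
Require Import Defs.
From HB Require Import structures.
From mathcomp Require Import all_boot all_order all_fingroup all_algebra.
From mathcomp Require Import all_classical all_reals all_analysis.
From mathcomp Require Import zify ring lra.
Import numFieldNormedType.Exports.
Import Order.TTheory GRing.Theory Num.Theory.

(** A topologically mixing exchange of four intervals is obtained as an
   infinitely renormalizable one, the freedom in the renormalization being
   spent on arithmetic.

   The intervals are called A, D, B, C from left to right, and their images
   come in the order D, C, B, A.  A closed loop of Rauzy inductions, with two
   arbitrary exponents m and n, shows that the exchange with suitable widths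
   induces, on a shorter interval starting at 0, an exchange of the same kind,
   the first-return itineraries of the four new pieces being
     A' = A B^m D^(n+1),               B' = A B^(m+1) D^(n+1),
     C' = A C D^n A C D^(n+1),         D' = A B^m D^(n+1) A C D^(n+1)
   ([block_induces]).  Given any sequence of exponents with m > 0, a limit of
   pulled back widths yields one exchange that can be renormalized this way
   forever ([widths_exist]).  Level k then has a base X_k, the domain of the
   k-th induced map, and its pieces have return times h_k(A), ..., h_k(D).

   An itinerary w of the level k map makes the weight of w, that is the sum of
   the h_k of its letters, a time at which some point of X_k is back in X_k.
   Inside a run of a+1 letters B' followed by D', the itineraries that are
   allowed have weights
     a H + i h(B) + j h(D)   and   a H + s + i h(B) + j h(D),
   where H = h(B'), s = h(A) + h(C) + (n+1) h(D), and i <= m and j <= n are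
   free.  If h(B) and h(D) are coprime, the numbers i h(B) + j h(D) fill an
   interval that is only a little shorter than H; the second family is the
   first one shifted by s, which falls short of H by about (m+1) h(B), and so it
   covers the gaps that the first one leaves around the multiples of H.  Hence
   all integers from h_k(B) h_k(D) to h_(k+1)(B) h_(k+1)(D) are return times of
   X_k ([return_words], [returns_step]), provided that m and n are large; the
   Chinese remainder theorem allows them to be large and such that the next
   h(B) and h(D) are coprime again ([next_exponents]).  As the X_k decrease,
   all large integers are return times of X_k, for every k ([returns_ge]).

   Finally every nonempty open set contains an iterate of some X_k, because
   the floors of the towers over the pieces become arbitrarily short
   ([dense_orbits]).  If U contains T^p(X_k) and V contains T^q(X_k), then
   T^n(U) meets V as soon as n + p - q is a return time of X_k. *)

Set Implicit Arguments.
Unset Strict Implicit.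
Unset Printing Implicit Defensive.

Local Open Scope nat_scope.

(** * Words and weights *)

Inductive letter := A | B | C | D.

Definition letter_eqb (c d : letter) : bool :=
  match c, d with
  | A, A | B, B | C, C | D, D => true
  | _, _ => false
  end.

Lemma letter_eqP : Equality.axiom letter_eqb.
Proof. by case; case; constructor. Qed.

HB.instance Definition _ := hasDecEq.Build letter letter_eqP.

Definition weight (h : letter -> nat) (w : seq letter) := sumn (map h w).

Lemma weight_cat h u w : weight h (u ++ w) = weight h u + weight h w.
Proof. by rewrite /weight map_cat sumn_cat. Qed.

Lemma weight_cons h c w : weight h (c :: w) = h c + weight h w.
Proof. by []. Qed.

Lemma weight_nseq h k c : weight h (nseq k c) = k * h c.
Proof. by rewrite /weight map_nseq sumn_nseq mulnC. Qed.

Definition substw (s : letter -> seq letter) (w : seq letter) :=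
  flatten (map s w).

Lemma substw_cat s u w : substw s (u ++ w) = substw s u ++ substw s w.
Proof. by rewrite /substw map_cat flatten_cat. Qed.

Lemma substw_cons s c w : substw s (c :: w) = s c ++ substw s w.
Proof. by []. Qed.

Lemma substw_nseq_fix s k c : s c = [:: c] -> substw s (nseq k c) = nseq k c.
Proof.
by move=> sc; elim: k => //= k IH; rewrite substw_cons sc IH.
Qed.

Lemma weight_substw h s w :
  weight h (substw s w) = weight (fun c => weight h (s c)) w.
Proof. by elim: w => //= c w IH; rewrite substw_cons weight_cat IH. Qed.

(** These are the itineraries of the four pieces under one renormalization; the
   proof that they occur is [block_induces]. The two exponents can be chosen
   freely, and every word begins with A, which puts each base inside a single
   piece of the previous level. *)
Definition block_word (m n : nat) (c : letter) : seq letter :=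
  match c with
  | A => A :: nseq m B ++ nseq n.+1 D
  | B => A :: nseq m.+1 B ++ nseq n.+1 D
  | C => [:: A, C & nseq n D] ++ [:: A, C & nseq n.+1 D]
  | D => (A :: nseq m B ++ nseq n.+1 D) ++ [:: A, C & nseq n.+1 D]
  end.

Lemma weight_block_wordB h m n :
  weight h (block_word m n B) = h A + m.+1 * h B + n.+1 * h D.
Proof.
by rewrite /block_word !(weight_cat, weight_cons, weight_nseq) addnA.
Qed.

Lemma weight_block_wordD h m n : weight h (block_word m n D) =
  h A + m * h B + n.+1 * h D + (h A + h C + n.+1 * h D).
Proof.
by rewrite /block_word !(weight_cat, weight_cons, weight_nseq) !addnA.
Qed.

(** * Arithmetic of the return times *)

Lemma coprime_solve b d r N : coprime b d -> 0 < b -> 0 < d ->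
  exists2 x, N <= x & x * b = r %[mod d].
Proof.
move=> cbd b0 d0; pose y := chinese b d 0 r.
have yb : b %| y by rewrite /dvdn chinese_modl // mod0n.
exists (y %/ b + N * d).
  by apply: leq_trans (leq_addl _ _); rewrite leq_pmulr.
rewrite mulnDl divnK // addnC mulnAC modnMDl.
exact: chinese_modr.
Qed.

Lemma coprime_modr1 x d : x = 1 %[mod d] -> coprime x d.
Proof. by move=> e; rewrite -coprime_modl e coprime_modl coprime1n. Qed.

(** Modulo the new h(B), the new h(D) is e = h(A) + h(C) + (n+1) h(D) - h(B),
   and the new h(B) minus e is g = (m+2) h(B) - h(C), free of n. Since h(B)
   is invertible modulo h(D), m can be chosen with g = 1 modulo h(D); then
   h(D) is invertible modulo g, and n can be chosen with e = 1 modulo g. The two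
   lower bounds are those that make the covering argument of [return_words]
   work. *)
Lemma next_exponents (h : letter -> nat) :
  (forall c, 0 < h c) -> coprime (h B) (h D) ->
  exists mn : nat * nat,
    [/\ 3 * h D + h A + h C <= mn.1, mn.1 * h B <= mn.2 &
     coprime (weight h (block_word mn.1 mn.2 B))
             (weight h (block_word mn.1 mn.2 D))].
Proof.
move=> h0 cBD.
have [hA hB hC hD] : [/\ 0 < h A, 0 < h B, 0 < h C & 0 < h D] by [].
have [m2 m2ge m2E] := coprime_solve (1 + h C)
  (3 * h D + h A + h C + 2) cBD hB hD.
have [m Em] : exists m, m2 = m + 2 by exists (m2 - 2); lia.
pose g := m2 * h B - h C.
have m2l : m2 <= m2 * h B by rewrite leq_pmulr.
have gE : g + h C = m2 * h B by rewrite /g; lia.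
have g1 : g = 1 %[mod h D].
  by apply/eqP; rewrite -(eqn_modDr (h C)) gE m2E.
have g0 : 0 < g by clear g1 m2E; lia.
have cDg : coprime (h D) g by rewrite coprime_sym coprime_modr1.
(* The target residue is 1 - h(A) - h(C) + h(B) modulo g; a multiple of g is
   added so that the truncated subtraction is exact. *)
have [n1 n1ge n1E] := coprime_solve
  (1 + g * (h A + h C + h B) - (h A + h C) + h B) (m * h B + 1) cDg hD g0.
case: n1 n1ge n1E => [|n] n1ge n1E; first by rewrite leqn0 addn1 in n1ge.
clear g1 m2E cDg.
have mB : h B <= m * h B by rewrite leq_pmull //; clear n1E; lia.
have nD : n.+1 <= n.+1 * h D by rewrite leq_pmulr.
have gX : h A + h C + h B <= g * (h A + h C + h B) by rewrite leq_pmull.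
exists (m, n) => /=; split; [clear n1E; lia | clear n1E; lia |].
rewrite weight_block_wordB weight_block_wordD.
pose e := h A + h C + n.+1 * h D - h B.
have eE : e + h B = h A + h C + n.+1 * h D by clear n1E; rewrite /e; lia.
have e1 : coprime e g.
  apply: coprime_modr1; apply/eqP.
  rewrite -(eqn_modDr (h B)) eE -modnDmr n1E modnDmr.
  rewrite (_ : _ + _ = (h A + h C + h B) * g + (1 + h B)); last first.
    by clear n1E; lia.
  by rewrite modnMDl.
have -> : h A + m.+1 * h B + n.+1 * h D = g + e by clear n1E e1; lia.
have -> : h A + m * h B + n.+1 * h D + (h A + h C + n.+1 * h D) = e + (g + e).
  by clear n1E e1; lia.
by rewrite /coprime gcdnDr gcdnC gcdnDr.
Qed.

(** Among d consecutive values of i exactly one makes x - i b divisible by d.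
   The smallest window, i < d, works while x is small; for larger x the last
   window, m - d < i <= m, keeps the quotient below n. *)
Lemma coprime_representation b d m n x : coprime b d -> 0 < b -> 0 < d ->
  d <= m -> m * b <= n * d ->
  b * d <= x <= n * d + (m - d) * b ->
  exists i j, [/\ i <= m, j <= n & x = i * b + j * d].
Proof.
move=> cbd b0 d0 dm mn /andP[xlo xhi].
(* The solution whose i lies in the window p <= i < p + d. *)
have in_window p : p + d <= m -> (p + d) * b <= x + b -> x <= n * d + p * b ->
  exists i j, [/\ i <= m, j <= n & x = i * b + j * d].
  move=> pd pl ph.
  have [i0 i0ge i0E] := coprime_solve x p cbd b0 d0.
  pose i := p + (i0 - p) %% d.
  have id : i < p + d by rewrite /i ltn_add2l ltn_pmod.
  have iE : i * b = x %[mod d].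
    rewrite -i0E /i mulnDl -modnDmr modnMml modnDmr -mulnDl subnKC //.
  have ix : i * b <= x.
    have : i.+1 * b <= (p + d) * b by rewrite leq_mul2r id orbT.
    by rewrite mulSn; clear i0E iE; lia.
  have dv : d %| x - i * b by rewrite -eqn_mod_dvd // iE.
  exists i, ((x - i * b) %/ d); split; first by clear i0E iE dv; lia.
    rewrite leq_divLR //.
    have : p * b <= i * b by rewrite leq_mul2r leq_addr orbT.
    clear i0E iE dv; lia.
  by rewrite divnK // subnKC.
case: (leqP x (m * b)) => xm.
  by apply: (in_window 0); rewrite ?add0n ?mul0n //; lia.
by apply: (in_window (m - d)); rewrite ?subnK //; lia.
Qed.

(** * Weights of the factors of a renormalized itinerary *)

Definition factor (w W : seq letter) := exists u v, W = u ++ w ++ v.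

Lemma factor_cat w U W V : factor w W -> factor w (U ++ W ++ V).
Proof.
by move=> [u [v ->]]; exists (U ++ u), (v ++ V); rewrite -!catA.
Qed.

Lemma nseq_split p i (x : letter) : i <= p ->
  nseq p x = nseq (p - i) x ++ nseq i x.
Proof. by move=> ip; rewrite -nseqD subnK. Qed.

Lemma block_wordB_split m n i j : i <= m.+1 -> j <= n ->
  block_word m n B = (A :: nseq (m.+1 - i) B) ++ (nseq i B ++ nseq j D) ++
               D :: nseq (n - j) D.
Proof.
move=> im jn; rewrite /block_word (nseq_split B im).
have -> : n.+1 = j + (n - j).+1 by lia.
by rewrite nseqD /= -!catA.
Qed.

Lemma block_wordD_split m n i j : i <= m -> j <= n ->
  block_word m n D = (A :: nseq (m - i) B) ++
    (nseq i B ++ nseq n.+1 D ++ [:: A; C] ++ nseq j D) ++ D :: nseq (n - j) D.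
Proof.
move=> im jn; rewrite /block_word (nseq_split B im).
have -> : [:: A, C & nseq n.+1 D] =
   [:: A; C] ++ nseq j D ++ D :: nseq (n - j) D.
  have -> : n.+1 = j + (n - j).+1 by lia.
  by rewrite nseqD.
by rewrite /= -!catA /= -?catA.
Qed.

(** The word is cut out of a+1 consecutive blocks B' by dropping
   A B^(m+1-i) at the beginning and D^(n+1-j) at the end. At least one D is
   left over, so that the factor can be followed by D: this puts the endpoint
   of the itinerary back in the base. *)
Lemma return_word_near h m n M a i j : a <= M -> i <= m -> j <= n ->
  exists2 w,
    factor (rcons w D) (substw (block_word m n) (nseq M.+1 B ++ [:: D])) &
    weight h w = a * weight h (block_word m n B) + i * h B + j * h D.
Proof.
move=> aM im jn.
have fW w : factor w (substw (block_word m n) (nseq a.+1 B)) ->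
    factor w (substw (block_word m n) (nseq M.+1 B ++ [:: D])).
  move=> f; have -> : M.+1 = (M - a) + a.+1 by lia.
  by rewrite nseqD -catA !substw_cat; apply: factor_cat.
have im1 : i <= m.+1 by lia.
case: a aM fW => [|a] aM fW.
  exists (nseq i B ++ nseq j D).
    apply: fW; exists (A :: nseq (m.+1 - i) B), (nseq (n - j) D).
    rewrite /substw [flatten _]cats0 (block_wordB_split im1 jn).
    by rewrite -cats1 -!catA.
  by rewrite weight_cat !weight_nseq.
exists ((nseq i B ++ nseq n.+1 D) ++ substw (block_word m n) (nseq a B) ++
         (A :: nseq m.+1 B ++ nseq j D)).
  apply: fW; exists (A :: nseq (m.+1 - i) B), (nseq (n - j) D).
  have -> : nseq a.+2 B = B :: nseq a B ++ [:: B].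
    by rewrite -(addn1 a.+1) nseqD.
  have WB : block_word m n B =
      (A :: nseq (m.+1 - i) B) ++ (nseq i B ++ nseq n.+1 D).
    by rewrite /block_word (nseq_split B im1) -catA.
  rewrite substw_cons substw_cat [substw _ [:: B]]cats0.
  rewrite {1}WB (block_wordB_split (leq0n _) jn).
  by rewrite subn0 -cats1 -?catA /= -?catA /= -?catA.
rewrite !(weight_cat, weight_cons, weight_nseq) weight_substw weight_nseq.
by rewrite weight_block_wordB; lia.
Qed.

(** The last block is now D', cut inside its final run of D: compared with
   [return_word_near] for a+1, one run B^(m+1) has been traded for the letter C,
   which moves the weight away from the multiples of the weight of B'. *)
Lemma return_word_far h m n M a i j : a <= M -> i <= m -> j <= n ->
  exists2 w,
    factor (rcons w D) (substw (block_word m n) (nseq M.+1 B ++ [:: D])) &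
    weight h w = a * weight h (block_word m n B) + (h A + h C + n.+1 * h D)
                 + i * h B + j * h D.
Proof.
move=> aM im jn.
have fW w : factor w (substw (block_word m n) (nseq a B ++ [:: D])) ->
    factor w (substw (block_word m n) (nseq M.+1 B ++ [:: D])).
  move=> f; have -> : M.+1 = (M.+1 - a) + a by lia.
  rewrite nseqD -catA substw_cat -[X in _ ++ X]cats0; exact: factor_cat.
case: a aM fW => [|a] aM fW.
  exists (nseq i B ++ nseq n.+1 D ++ [:: A; C] ++ nseq j D).
    apply: fW; exists (A :: nseq (m - i) B), (nseq (n - j) D).
    by rewrite cat0s [substw _ _]cats0 (block_wordD_split im jn) -cats1 -!catA.
  by rewrite !(weight_cat, weight_cons, weight_nseq) /weight /=; lia.
exists ((nseq i.+1 B ++ nseq n.+1 D) ++ substw (block_word m n) (nseq a B) ++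
  (A :: nseq (m - 0) B) ++ (nseq 0 B ++ nseq n.+1 D ++ [:: A; C] ++ nseq j D)).
  apply: fW; exists (A :: nseq (m.+1 - i.+1) B), (nseq (n - j) D).
  have im1 : i.+1 <= m.+1 by lia.
  have WB : block_word m n B =
      (A :: nseq (m.+1 - i.+1) B) ++ (nseq i.+1 B ++ nseq n.+1 D).
    by rewrite /block_word (nseq_split B im1) -catA.
  rewrite /= substw_cons substw_cat [substw _ [:: D]]cats0.
  rewrite {1}WB (block_wordD_split (leq0n _) jn).
  by rewrite -cats1 -?catA /= -?catA /= -?catA.
rewrite !(weight_cat, weight_cons, weight_nseq) weight_substw weight_nseq.
by rewrite weight_block_wordB /weight /=; lia.
Qed.

(** Write t = a H + x with h(B) h(D) <= x < h(B) h(D) + H, where H is the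
   weight of B'. Either x itself is of the form i h(B) + j h(D), or it
   is so large that x - s is, where s = h(A) + h(C) + (n+1) h(D): the lower
   bound on m makes the range of x reach s + h(B) h(D), and the one on n makes
   the shifted range reach H + h(B) h(D). *)
Lemma return_words h m n M t : coprime (h B) (h D) ->
  (forall c, 0 < h c) ->
  3 * h D + h A + h C <= m -> m * h B <= n ->
  h B * h D <= t <= h B * h D + M * weight h (block_word m n B) ->
  exists2 w,
    factor (rcons w D) (substw (block_word m n) (nseq M.+1 B ++ [:: D])) &
    weight h w = t.
Proof.
move=> cBD h0 mge nge /andP[tge tle].
have [hA hB hC hD] : [/\ 0 < h A, 0 < h B, 0 < h C & 0 < h D] by [].
set lo := h B * h D in tge tle; set H := weight _ _ in tle.
have H0 : 0 < H by rewrite /H weight_block_wordB; lia.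
pose a := (t - lo) %/ H; pose r := (t - lo) %% H.
have tE : t = a * H + (lo + r) by rewrite addnCA -divn_eq subnKC.
have aM : a <= M.
  by rewrite -(leq_pmul2r H0); have := leq_trunc_div (t - lo) H; lia.
have nD : n <= n * h D by rewrite leq_pmulr.
have rH : r < H by rewrite ltn_pmod.
have dm : h D <= m by lia.
have mn : m * h B <= n * h D by lia.
have b3 : 3 * h D * h B <= m * h B by rewrite leq_mul2r; lia.
have mB : (m - h D) * h B = m * h B - h D * h B by rewrite mulnBl.
have mB2 : (h D + (h D + h A + h C)) * h B <= (m - h D) * h B.
  by rewrite leq_mul2r; lia.
have mB3 : h D + h A + h C <= (h D + h A + h C) * h B by rewrite leq_pmulr.
rewrite mulnDl [h D * h B]mulnC -/lo in mB2.
have n3 : 3 * lo <= n * h D by rewrite /lo; lia.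
have bl : h B <= lo by rewrite leq_pmulr.
case: (leqP (lo + r) (n * h D + (m - h D) * h B)) => rhi.
  have [|i [j [im jn E]]] :=
    coprime_representation cBD hB hD dm mn (x := lo + r).
    by rewrite leq_addr.
  have [w fw ww] := return_word_near h aM im jn.
  by exists w => //; rewrite ww tE E addnA.
pose s := h A + h C + n.+1 * h D.
have sE : lo + r <= s + n * h D + (m - h D) * h B.
  by move: rH; rewrite /H weight_block_wordB /s; lia.
have [|i [j [im jn E]]] :=
  coprime_representation cBD hB hD dm mn (x := lo + r - s).
  by rewrite /s in sE *; lia.
have [w fw ww] := return_word_far h aM im jn.
by exists w => //; rewrite ww tE -/s -addnA -E /s -/H; lia.
Qed.

Local Open Scope classical_set_scope.
Local Open Scope ring_scope.

(** * Piecewise translations and Rauzy induction *)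

(** Only the pieces and their translations are recorded: Rauzy induction can
   then be checked locally, whatever the arrangement of the pieces. *)
Record exchange (R : Type) := Exchange {
  left : letter -> R;
  width : letter -> R;
  shift : letter -> R
}.

Definition in_piece (R : realFieldType) (S : exchange R) (c : letter) (x : R) :=
  left S c <= x /\ x < left S c + width S c.

(** The itinerary is kept as a relation between its endpoints: no map on all of
   R has to be chosen, and the translations along w are visible. *)
Fixpoint follows (R : realFieldType) (S : exchange R) (w : seq letter)
    (x y : R) :=
  if w is c :: w' then in_piece S c x /\ follows S w' (x + shift S c) y
  else x = y.

(** The pieces of S' are subsets of the domain of S on which S' is an iterate
   of S with itinerary s; the second clause says that the towers over these
   pieces cover the domain of S. *)
Record induces (R : realFieldType) (S S' : exchange R)
    (s : letter -> seq letter) : Prop := Induces {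
  induces_follows : forall c x, in_piece S' c x ->
    follows S (s c) x (x + shift S' c);
  induces_cover : forall c y, in_piece S c y -> exists c' x u v,
    [/\ in_piece S' c' x, s c' = u ++ c :: v & follows S u x y]
}.

Section Follows.
Variable R : realFieldType.
Implicit Types (S : exchange R).

Lemma follows_cat S u w x z : follows S (u ++ w) x z <->
  exists2 y, follows S u x y & follows S w y z.
Proof.
elim: u x => [|c u IH] x /=.
  by split=> [f|[y -> //]]; exists x.
split=> [[px /IH[y fu fw]]|[y [px fu] fw]]; first by exists y.
by split=> //; apply/IH; exists y.
Qed.

Lemma follows_substw S S' s w x y : induces S S' s ->
  follows S' w x y -> follows S (substw s w) x y.
Proof.
move=> i; elim: w x => [|c w IH] x //= [px fw].
apply/follows_cat; exists (x + shift S' c); last exact: IH.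
exact: induces_follows.
Qed.

Lemma induces_trans S S' S'' s s' : induces S S' s -> induces S' S'' s' ->
  induces S S'' (fun c => substw s (s' c)).
Proof.
move=> i i'; split=> [c x px|c y py].
  by apply: (follows_substw i); apply: induces_follows px.
have [c' [x [u [v [px sE fu]]]]] := induces_cover i py.
have [c'' [x' [u' [v' [px' sE' fu']]]]] := induces_cover i' px.
exists c'', x', (substw s u' ++ u), (v ++ substw s v'); split=> //.
  by rewrite sE' substw_cat substw_cons sE -!catA.
by apply/follows_cat; exists x => //; apply: follows_substw fu'.
Qed.

Lemma induces_refl S : induces S S (fun c => [:: c]).
Proof.
split=> [c x px //|c y py].
by exists c, y, [::], [::].
Qed.

(** Rauzy induction where the last piece w of the domain is wider than the
   piece l whose image is rightmost. The piece l is sent to the right end of w,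
   which is cut off: the points of l follow l then w, and the cut part of w is
   the image of l. *)
Lemma rauzy_top S S' w l : l != w ->
  0 <= width S' w -> 0 <= width S l ->
  left S' =1 left S -> (forall c, c != w -> width S' c = width S c) ->
  (forall c, c != l -> shift S' c = shift S c) ->
  width S w = width S' w + width S l ->
  shift S' l = shift S l + shift S w ->
  left S l + shift S l = left S w + width S' w ->
  induces S S' (fun c => if c == l then [:: l; w] else [:: c]).
Proof.
move=> lw w0 l0 leE wE shE wwE slE El; split=> [c x|c y].
  case: eqP => [->|/eqP cl].
    rewrite /in_piece /= /in_piece slE leE wE // => -[lx xl].
    by do !split; lra.
  rewrite /in_piece /= /in_piece leE shE // => -[lx xl].
  have [cw|cw] := eqVneq c w; last by rewrite wE // in xl.
  by rewrite cw in lx xl *; do !split; lra.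
move=> [ly yl].
have [cw|cw] := eqVneq c w; last first.
  exists c, y, [::], (if c == l then [:: w] else [::]); split=> //.
    by rewrite /in_piece leE wE.
  by case: eqP => // ->.
have [yw|yw] := ltP y (left S w + width S' w); rewrite cw in ly yl *.
  exists w, y, [::], [::]; split=> //; first by split; rewrite leE.
  by rewrite eq_sym (negbTE lw).
exists l, (y - shift S l), [:: l], [::]; rewrite eqxx; split=> //.
  by split; rewrite leE ?(wE _ lw); lra.
by rewrite /= /in_piece; do !split; lra.
Qed.

(** Rauzy induction where the piece w with the rightmost image is wider than
   the last piece l of the domain. The piece l is cut off, and its preimage,
   the right end of w, takes over its name: these points follow w then l. *)
Lemma rauzy_bottom S S' w l : l != w ->
  0 <= width S' w -> 0 <= width S l ->
  shift S' l = shift S w + shift S l ->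
  (forall c, c != l -> shift S' c = shift S c) ->
  (forall c, c != w -> width S' c = width S c) ->
  width S w = width S' w + width S l ->
  (forall c, c != l -> left S' c = left S c) ->
  left S' l = left S w + width S' w ->
  left S l = left S w + shift S w + width S' w ->
  induces S S' (fun c => if c == l then [:: w; l] else [:: c]).
Proof.
move=> lw w0 l0 slE shE wE wwE leE llE El; split=> [c x|c y].
  case: eqP => [->|/eqP cl].
    rewrite /in_piece /= /in_piece slE llE (wE _ lw) => -[lx xl].
    by do !split; lra.
  rewrite /in_piece /= /in_piece leE ?shE // => -[lx xl].
  have [cw|cw] := eqVneq c w; last by rewrite wE // in xl.
  by rewrite cw in lx xl *; do !split; lra.
move=> [ly yl].
have [cl|cl] := eqVneq c l.
  rewrite cl in ly yl *.
  exists l, (y - shift S w), [:: w], [::]; rewrite eqxx; split=> //.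
    by split; rewrite llE ?(wE _ lw); lra.
  by rewrite /= /in_piece; do !split; lra.
have [cw|cw] := eqVneq c w; last first.
  exists c, y, [::], [::]; rewrite (negbTE cl); split=> //.
  by split; rewrite ?leE ?wE.
rewrite cw in cl ly yl *.
have [yw|yw] := ltP y (left S w + width S' w).
  exists w, y, [::], [::]; rewrite (negbTE cl); split=> //.
  by split; rewrite leE.
exists l, y, [::], [:: l]; rewrite eqxx; split=> //.
by split; rewrite llE ?(wE _ lw); lra.
Qed.

End Follows.

Fixpoint start (R : realFieldType) (s : seq letter)
    (v : letter -> R) (c : letter) : R :=
  if s is d :: s' then if c == d then 0 else v d + start s' v c else 0.

Definition iet (R : realFieldType) (top bot : seq letter) (v : letter -> R) :=
  Exchange (start top v) v (fun c => start bot v c - start top v c).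

(** Rauzy induction subtracts the width of the loser from that of the winner;
   widths are parametrized here by those after the step, so that positivity
   of the latter is the only condition. *)
Definition gain (R : realFieldType) (w l : letter) (v : letter -> R)
    (c : letter) : R :=
  if c == w then v w + v l else v c.

Section Arrows.
Variable R : realFieldType.
Implicit Type v : letter -> R.

Definition top_subst (w l c : letter) :=
  if c == l then [:: l; w] else [:: c].
Definition bottom_subst (w l c : letter) :=
  if c == l then [:: w; l] else [:: c].

Ltac solve_rauzy v0 :=
  rewrite //= /gain /=; try (by move: (v0 A) (v0 B) (v0 C) (v0 D); lra);
  try (by case; rewrite //= => *; lra).

(** The eight steps that follow are the arrows of the closed loop of
   [block_induces] in the Rauzy diagram, X_beats_Y being the step with winner X
   and loser Y. In each case only the equations between widths and
   translations have to be checked. *)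
Lemma A_beats_C v (v0 : forall c, 0 < v c) :
  induces (iet [:: A; D; B; C] [:: D; C; B; A] (gain A C v))
          (iet [:: A; C; D; B] [:: D; C; B; A] v) (bottom_subst A C).
Proof. by apply: rauzy_bottom; solve_rauzy v0. Qed.

Lemma B_beats_A v (v0 : forall c, 0 < v c) :
  induces (iet [:: A; C; D; B] [:: D; C; B; A] (gain B A v))
          (iet [:: A; C; D; B] [:: D; C; B; A] v) (top_subst B A).
Proof. by apply: rauzy_top; solve_rauzy v0. Qed.

Lemma A_beats_B v (v0 : forall c, 0 < v c) :
  induces (iet [:: A; C; D; B] [:: D; C; B; A] (gain A B v))
          (iet [:: A; B; C; D] [:: D; C; B; A] v) (bottom_subst A B).
Proof. by apply: rauzy_bottom; solve_rauzy v0. Qed.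

Lemma D_beats_A v (v0 : forall c, 0 < v c) :
  induces (iet [:: A; B; C; D] [:: D; C; B; A] (gain D A v))
          (iet [:: A; B; C; D] [:: D; A; C; B] v) (top_subst D A).
Proof. by apply: rauzy_top; solve_rauzy v0. Qed.

Lemma D_beats_B v (v0 : forall c, 0 < v c) :
  induces (iet [:: A; B; C; D] [:: D; A; C; B] (gain D B v))
          (iet [:: A; B; C; D] [:: D; B; A; C] v) (top_subst D B).
Proof. by apply: rauzy_top; solve_rauzy v0. Qed.

Lemma D_beats_C v (v0 : forall c, 0 < v c) :
  induces (iet [:: A; B; C; D] [:: D; B; A; C] (gain D C v))
          (iet [:: A; B; C; D] [:: D; C; B; A] v) (top_subst D C).
Proof. by apply: rauzy_top; solve_rauzy v0. Qed.

Lemma C_beats_D v (v0 : forall c, 0 < v c) :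
  induces (iet [:: A; B; C; D] [:: D; B; A; C] (gain C D v))
          (iet [:: A; B; C; D] [:: D; B; A; C] v) (bottom_subst C D).
Proof. by apply: rauzy_bottom; solve_rauzy v0. Qed.

Lemma A_beats_D v (v0 : forall c, 0 < v c) :
  induces (iet [:: A; B; C; D] [:: D; C; B; A] (gain A D v))
          (iet [:: A; D; B; C] [:: D; C; B; A] v) (bottom_subst A D).
Proof. by apply: rauzy_bottom; solve_rauzy v0. Qed.

End Arrows.

Section Block.
Variable R : realFieldType.
Implicit Type v : letter -> R.

Lemma induces_ext t b (S' : exchange R) v v' s s' : v =1 v' -> s =1 s' ->
  induces (iet t b v) S' s -> induces (iet t b v') S' s'.
Proof. by move=> /funext -> /funext ->. Qed.

Lemma gain_gt0 w l v : (forall c, 0 < v c) -> forall c, 0 < gain w l v c.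
Proof. by move=> v0 c; rewrite /gain; case: ifP => // _; apply: addr_gt0. Qed.

(** This arrow is a loop of the Rauzy diagram; going m times around it creates
   the power B^m. *)
Lemma B_beats_A_iter m v (v0 : forall c, 0 < v c) :
  induces (iet [:: A; C; D; B] [:: D; C; B; A]
             (fun c => if c == B then v B + m%:R * v A else v c))
          (iet [:: A; C; D; B] [:: D; C; B; A] v)
          (fun c => if c == A then A :: nseq m B else [:: c]).
Proof.
elim: m => [|m IH].
  apply: induces_ext (induces_refl _).
    by case=> //=; rewrite mul0r addr0.
  by case.
have i0 c : 0 < (if c == B then v B + m%:R * v A else v c).
  by case: ifP => // _; rewrite ltr_wpDr // mulr_ge0 // ltW.
apply: induces_ext (induces_trans (B_beats_A i0) IH).
  by case => //=; rewrite /gain /= -natr1; ring.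
case => //=.
rewrite /top_subst /= substw_cons substw_nseq_fix //=.
Qed.

(** The three victories of D form a cycle of the Rauzy diagram; going n times
   around it creates the power D^n. *)
Lemma D_beats_ABC v (v0 : forall c, 0 < v c) :
  induces (iet [:: A; B; C; D] [:: D; C; B; A]
             (fun c => if c == D then v D + (v A + v B + v C) else v c))
          (iet [:: A; B; C; D] [:: D; C; B; A] v)
          (fun c => if c == D then [:: D] else [:: c; D]).
Proof.
have v1 := gain_gt0 D C v0; have v2 := gain_gt0 D B v1.
apply: induces_ext (induces_trans (D_beats_A v2)
                   (induces_trans (D_beats_B v1) (D_beats_C v0))).
  by case=> //=; rewrite /gain /=; ring.
by case.
Qed.

Lemma D_beats_ABC_iter n v (v0 : forall c, 0 < v c) :
  induces (iet [:: A; B; C; D] [:: D; C; B; A]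
             (fun c => if c == D then v D + n%:R * (v A + v B + v C) else v c))
          (iet [:: A; B; C; D] [:: D; C; B; A] v)
          (fun c => if c == D then [:: D] else c :: nseq n D).
Proof.
elim: n => [|n IH].
  apply: induces_ext (induces_refl _).
    by case=> //=; rewrite mul0r addr0.
  by case.
have i0 c : 0 < (if c == D then v D + n%:R * (v A + v B + v C) else v c).
  by case: ifP => // _; rewrite ltr_wpDr // mulr_ge0 // ltW // !addr_gt0.
apply: induces_ext (induces_trans (D_beats_ABC i0) IH).
  by case => //=; rewrite -natr1; ring.
by case => //=; rewrite substw_cons substw_nseq_fix.
Qed.

(** The coefficient of [v d] in the width of c is the number of occurrences of c
   in [block_word m n d]. *)
Definition block_widths (m n : nat) (v : letter -> R) (c : letter) : R :=
  match c with
  | A => v A + v B + 2 * v C + 2 * v D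
  | B => m%:R * v A + m.+1%:R * v B + m%:R * v D
  | C => 2 * v C + v D
  | D => n.+1%:R * v A + n.+1%:R * v B + (2 * n + 1)%:R * v C
         + (2 * n.+1)%:R * v D
  end.

(** The loop of victories is A over C, m times B over A, A over B, n times D
   over A, B and C, then D over A, D over B, C over D, D over C and A over D. *)
Lemma block_induces m n v (v0 : forall c, 0 < v c) :
  induces (iet [:: A; D; B; C] [:: D; C; B; A] (block_widths m n v))
          (iet [:: A; D; B; C] [:: D; C; B; A] v) (block_word m n).
Proof.
have v1 := gain_gt0 A D v0.
have v2 := gain_gt0 D C v1.
have v3 := gain_gt0 C D v2.
have v4 := gain_gt0 D B v3.
have v5 := gain_gt0 D A v4.
set w5 := gain D A _ in v5.
have v6 c : 0 < (if c == D then w5 D + n%:R * (w5 A + w5 B + w5 C) else w5 c).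
  by case: ifP => // _; rewrite ltr_wpDr // mulr_ge0 // ltW // !addr_gt0.
have v7 := gain_gt0 A B v6.
set w7 := gain A B _ in v7.
have v8 c : 0 < (if c == B then w7 B + m%:R * w7 A else w7 c).
  by case: ifP => // _; rewrite ltr_wpDr // mulr_ge0 // ltW.
apply: induces_ext
  (induces_trans (A_beats_C v8)
  (induces_trans (B_beats_A_iter m v7)
  (induces_trans (A_beats_B v6)
  (induces_trans (D_beats_ABC_iter n v5)
  (induces_trans (D_beats_A v4)
  (induces_trans (D_beats_B v3)
  (induces_trans (C_beats_D v2)
  (induces_trans (D_beats_C v1)
                 (A_beats_D v0))))))))).
  by case; rewrite /w7 /w5 /gain /= ?natrD ?natrM -?natr1; ring.
have nseq_comm k (c : letter) (w : seq letter) :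
    nseq k c ++ c :: w = c :: nseq k c ++ w.
  by elim: k => //= k ->.
have substw0 (s : letter -> seq letter) : substw s [::] = [::] by [].
pose E := (substw_cat, substw_cons, substw0, substw_nseq_fix, cats0).
by case; rewrite /top_subst /bottom_subst /= ?E /= ?E /= ?E /= ?E /= ?E /= ?E
     /= ?E /= ?E /= -?catA /= ?nseq_comm ?cats0.
Qed.

End Block.

(** * Widths that can be renormalized forever *)

Section Widths.
Variables (R : realType) (mn : nat -> nat * nat).
Implicit Type u : letter -> R.

Definition total_width u : R := u A + u B + u C + u D.

Definition level_widths k u : letter -> R := block_widths (mn k).1 (mn k).2 u.

(** Widths at level k obtained from four unit widths at level k + j. *)
Fixpoint pullback k j : letter -> R :=
  if j is j'.+1 then level_widths k (pullback k.+1 j') else fun=> 1.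

Lemma level_widths_gt0 k u : (forall c, 0 < u c) -> (0 < (mn k).1)%N ->
  forall c, 0 < level_widths k u c.
Proof.
move=> u0 m0 c.
by case: c; rewrite /level_widths /= ?addr_gt0 ?mulr_gt0 ?ltr0n //; lia.
Qed.

Lemma total_level_widths k u : (forall c, 0 <= u c) ->
  total_width u <= total_width (level_widths k u).
Proof.
move=> u0; rewrite /total_width /level_widths /= ?natrD ?natrM -?natr1.
have := (mulr_ge0 (ler0n R (mn k).1) (u0 A), mulr_ge0 (ler0n R (mn k).1) (u0 B),
 mulr_ge0 (ler0n R (mn k).1) (u0 D), mulr_ge0 (ler0n R (mn k).2) (u0 A),
  mulr_ge0 (ler0n R (mn k).2) (u0 B), mulr_ge0 (ler0n R (mn k).2) (u0 C),
  mulr_ge0 (ler0n R (mn k).2) (u0 D), u0 A, u0 B, u0 C, u0 D).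
by do 10! case; lra.
Qed.

Lemma level_widths_scale k u t c :
  level_widths k u c / t = level_widths k (fun d => u d / t) c.
Proof. by rewrite /level_widths; case: c => /=; ring. Qed.

Hypothesis mn0 : forall k, (0 < (mn k).1)%N.

Lemma pullback_gt0 k j c : 0 < pullback k j c.
Proof.
elim: j k c => [|j IH] k c //=.
by exact: level_widths_gt0.
Qed.

Lemma total_pullback k j :
  total_width (pullback k j) <= total_width (pullback 0 (k + j)).
Proof.
elim: k j => [|k IH] j //.
apply: (le_trans (y := total_width (pullback k j.+1))).
  by apply: total_level_widths => c; apply/ltW/pullback_gt0.
by rewrite addSnnS.
Qed.

(** Widths at level k of the exchange that can be renormalized K times and has
   total width 1 at level 0. *)
Definition approx K k c : R :=
  pullback k (K - k) c / total_width (pullback 0 K).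

Lemma total_width_gt0 u : (forall c, 0 < u c) -> 0 < total_width u.
Proof. by move=> u0; rewrite /total_width !addr_gt0. Qed.

Lemma approx_step K k c : (k < K)%N ->
  approx K k c = level_widths k (approx K k.+1) c.
Proof.
move=> kK; rewrite /approx -level_widths_scale.
by have -> : (K - k = (K - k.+1).+1)%N by lia.
Qed.

Lemma approx_bound K k c : (k <= K)%N -> 0 <= approx K k c <= 1.
Proof.
move=> kK; have t0 := total_width_gt0 (pullback_gt0 0 K).
rewrite /approx; apply/andP; split.
  by apply: divr_ge0; [apply/ltW/pullback_gt0|apply: ltW].
rewrite ler_pdivrMr // mul1r.
apply: (le_trans (y := total_width (pullback k (K - k)))); last first.
  by have := total_pullback k (K - k); rewrite subnKC.
rewrite /total_width.
have := (pullback_gt0 k (K - k) A, pullback_gt0 k (K - k) B,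
         pullback_gt0 k (K - k) C, pullback_gt0 k (K - k) D).
by do 3! case; case: c; lra.
Qed.

(** The approximate widths lie in [0,1], hence converge along an ultrafilter,
   for all levels at once; the recursion and the total width pass to the limit.
   No limit width vanishes: the total at each level is nonzero, and D' contains
   all four letters while D occurs in all four words, so that any positive
   width makes every width positive two levels below. *)
Lemma widths_exist : exists v : nat -> letter -> R,
  [/\ forall k c, v k c = level_widths k (v k.+1) c,
      forall k c, 0 < v k c & total_width (v 0%N) = 1].
Proof.
have [U [UU oU]] := @ultraFilterLemma _ (\oo : set_system nat) _.
have lim_ex (kc : nat * letter) : exists l : R,
    0 <= l <= 1 /\ (fun K => approx K kc.1 kc.2) @ U --> l.
  have /(_ _ _)[] := @segment_compact R 0 1 (approx K kc.1 kc.2 @[K --> U]) _.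
    apply: oU; exists kc.1 => // K /= kK.
    by rewrite in_itv /=; apply: approx_bound.
  move=> l [/=]; rewrite in_itv /= => l01 cl; exists l; split=> // V lV.
  have [//|UV] := in_ultra_setVsetC
    ((fun K => approx K kc.1 kc.2) @^-1` V) UU.
  by have [x []] := cl (~` V) V UV lV.
have [f fP] := choice lim_ex.
pose v k c := f (k, c).
have vl k c : (fun K => approx K k c) @ U --> v k c by have [] := fP (k, c).
have v0 k c : 0 <= v k c by have [/andP[]] := fP (k, c).
have vE k c : v k c = level_widths k (v k.+1) c.
  have lim2 : (fun K => approx K k c) @ U --> level_widths k (v k.+1) c.
    have e : \forall K \near U, level_widths k (approx K k.+1) c = approx K k c.
      by apply: oU; exists k.+1 => // K /= kK; rewrite approx_step.
    apply: cvg_trans (near_eq_cvg e) _.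
    rewrite /level_widths; case: c {e} => /=; repeat apply: cvgD; 
     try exact: vl; apply: cvgM => //; exact: cvg_cst.
  exact: cvg_unique (vl k c) lim2.
have t1 : total_width (v 0%N) = 1.
  have lim1 : (fun K => total_width (approx K 0)) @ U --> total_width (v 0%N).
    by rewrite /total_width; repeat apply: cvgD; exact: vl.
  have E1 : (fun K => total_width (approx K 0)) = fun=> 1.
    apply: funext => K; rewrite {1}/total_width /approx -!mulrDl subn0.
    by rewrite divff // gt_eqF // total_width_gt0 // => c; apply: pullback_gt0.
  by rewrite E1 in lim1; apply: cvg_unique lim1 (cvg_cst _).
have tpos k : 0 < total_width (v k).
  elim: k => [|k IH]; first by rewrite t1.
  rewrite ltNge; apply/negP => tle.
  have z c : v k.+1 c = 0.
    have := (v0 k.+1 A, v0 k.+1 B, v0 k.+1 C, v0 k.+1 D).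
    by move: tle; rewrite /total_width => ? [[[]]]; case: c; lra.
  by move: IH; rewrite /total_width !vE /level_widths /= !z; lra.
have Dpos k : 0 < v k D.
  apply: lt_le_trans (tpos k.+1) _; rewrite vE /level_widths /total_width /=.
  by rewrite !lerD // ler_peMl // ler1n; lia.
exists v; split=> // k c.
have m1 : 0 < (mn k).1%:R :> R by rewrite ltr0n.
have := mulr_gt0 m1 (Dpos k.+1).
have := (mulr_ge0 (ltW m1) (v0 k.+1 A), mulr_ge0 (ltW m1) (v0 k.+1 B)).
have := (v0 k.+1 A, v0 k.+1 B, v0 k.+1 C, Dpos k.+1).
move=> [[[? ?] ?] ?] [? ?] ?.
by case: c; last exact: Dpos; rewrite vE /level_widths /= -?natr1; lra.
Qed.

End Widths.

(** * Return times and dense orbits *)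

Lemma follows_translation (R : realFieldType) (S : exchange R) w x y x' y' :
  follows S w x y -> follows S w x' y' -> y - x = y' - x'.
Proof.
elim: w x x' => [|c w IH] x x' /=; first by move=> -> ->; rewrite !subrr.
by move=> [_ f] [_ f']; have := IH _ _ f f'; lra.
Qed.

(** [h k c] is the return time of the piece c of level k to the base of that
   level, measured in iterates of the original exchange. *)
Record admissible (mn : nat -> nat * nat) (h : nat -> letter -> nat) : Prop := {
  heights0 : forall c, h 0%N c = 1%N;
  heightsS : forall k c,
    h k.+1 c = weight (h k) (block_word (mn k).1 (mn k).2 c);
  heights_coprime : forall k, coprime (h k B) (h k D);
  exponent1_ge : forall k, (3 * h k D + h k A + h k C <= (mn k).1)%N;
  exponent2_ge : forall k, ((mn k).1 * h k B <= (mn k).2)%N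
}.

Lemma admissible_exist : exists mn h, admissible mn h.
Proof.
pose good (h : letter -> nat) := (forall c, (0 < h c)%N) /\ coprime (h B) (h D).
have [f fP] : exists f : (letter -> nat) -> nat * nat, forall h, good h ->
    [/\ (3 * h D + h A + h C <= (f h).1)%N, ((f h).1 * h B <= (f h).2)%N &
     coprime (weight h (block_word (f h).1 (f h).2 B))
             (weight h (block_word (f h).1 (f h).2 D))].
  suff /choice[f fP] : forall h, exists mn : nat * nat, good h ->
      [/\ (3 * h D + h A + h C <= mn.1)%N, (mn.1 * h B <= mn.2)%N &
       coprime (weight h (block_word mn.1 mn.2 B))
             (weight h (block_word mn.1 mn.2 D))].
    by exists f.
  move=> h; case: (pselect (good h)) => [[h0 cp]|ng].
    by have [mn ?] := next_exponents h0 cp; exists mn.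
  by exists (0, 0)%N => g; case: (ng g).
pose next h c := weight h (block_word (f h).1 (f h).2 c).
pose h k := iter k next (fun=> 1%N).
have gh k : good (h k).
  elim: k => [|k [h0 cp]]; first by split.
  have [_ _ cp'] := fP _ (conj h0 cp); split=> // c.
  by rewrite /h iterS -/(h k) /next; case: c; rewrite weight_cons addn_gt0 h0.
exists (fun k => f (h k)), h; split=> // k; have [? ? ?] := fP _ (gh k) => //.
by case: (gh k).
Qed.

Section Renormalization.
Variables (R : realType) (mn : nat -> nat * nat) (h : nat -> letter -> nat).
Hypothesis adm : admissible mn h.
Variable v : nat -> letter -> R.
Hypothesis vE : forall k c, v k c = level_widths mn k (v k.+1) c.
Hypothesis v0 : forall k c, 0 < v k c.
Hypothesis total1 : total_width (v 0%N) = 1.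

Let S k := iet [:: A; D; B; C] [:: D; C; B; A] (v k).
Let block k := block_word (mn k).1 (mn k).2.

Lemma induces_step k : induces (S k) (S k.+1) (block k).
Proof.
rewrite /S (_ : v k = level_widths mn k (v k.+1)); first exact: block_induces.
exact/funext.
Qed.

Fixpoint tower_word k : letter -> seq letter :=
  if k is k'.+1 then fun c => substw (tower_word k') (block k' c)
  else fun c => [:: c].

Lemma induces_tower k : induces (S 0) (S k) (tower_word k).
Proof.
elim: k => [|k IH]; first exact: induces_refl.
exact: induces_trans IH (induces_step k).
Qed.

Lemma size_tower k w : size (substw (tower_word k) w) = weight (h k) w.
Proof.
elim: k w => [|k IH] w.
  elim: w => [//|c w IH]; rewrite substw_cons size_cat IH weight_cons.
  by rewrite (heights0 adm).
elim: w => [//|c w IHw]; rewrite substw_cons size_cat IHw weight_cons /= IH.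
by rewrite (heightsS adm).
Qed.

(** Every word of a renormalization contains both A and D, so that the smallest
   return time strictly increases. *)
Lemma heights_ge k c : (k < h k c)%N.
Proof.
elim: k c => [|k IH] c; first by rewrite (heights0 adm).
have [IA ID] := (IH A, IH D).
by rewrite (heightsS adm); case: c;
  rewrite !(weight_cat, weight_cons, weight_nseq); lia.
Qed.

Lemma exponent1_gt0 k : (0 < (mn k).1)%N.
Proof. by have := exponent1_ge adm k; have := heights_ge k D; lia. Qed.

(** The floors of the towers of level k have total length 1. This is invariant
   because widths and return times are transformed by transposed matrices. *)
Lemma towers_area k :
  (h k A)%:R * v k A + (h k B)%:R * v k B + (h k C)%:R * v k C
    + (h k D)%:R * v k D = 1.
Proof.
elim: k => [|k IH]; first by rewrite !(heights0 adm) !mul1r.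
rewrite -[RHS]IH.
rewrite !(heightsS adm) !(vE k) /level_widths.
rewrite !(weight_cat, weight_cons, weight_nseq) /block_widths.
rewrite !(natrD, natrM, mulrSr) !add0r; ring.
Qed.

Lemma width_small k c : v k c <= k.+1%:R^-1.
Proof.
have hv d : k.+1%:R * v k d <= (h k d)%:R * v k d.
  by rewrite ler_wpM2r ?ler_nat ?heights_ge // ltW.
have p d : 0 < k.+1%:R * v k d by rewrite mulr_gt0.
rewrite -[_^-1]mul1r ler_pdivlMr // mulrC.
have := towers_area k; have := (hv A, hv B, hv C, hv D, p A, p B, p C, p D).
by move=> [[[[[[[? ?] ?] ?] ?] ?] ?] ?] ?; case: c; lra.
Qed.

(** The domain of the level k map. *)
Definition base k x := exists c, in_piece (S k) c x.

Lemma base_A k x : base k.+1 x -> in_piece (S k) A x.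
Proof.
move=> [c px]; have := induces_follows (induces_step k) px.
by rewrite /block; case: c {px} => /= -[].
Qed.

Lemma base_le k K x : (k <= K)%N -> base K x -> base k x.
Proof.
move=> /subnKC <-; elim: (K - k)%N => [|j IH]; rewrite ?addn0 // addnS.
by move=> /base_A px; apply: IH; exists A.
Qed.

Lemma base_inhabited k c : exists x, in_piece (S k) c x.
Proof.
exists (left (S k) c); split=> //.
by rewrite ltrDl; apply: v0.
Qed.

Definition returns k n := exists x y w,
  [/\ base k x, base k y, follows (S 0) w x y & size w = n].

Definition threshold k := (h k B * h k D)%N.

(** The run of m+1 letters B followed by D, in the itinerary of the piece B of
   level k+2, supplies the blocks that [return_words] needs at level k; the
   exponent m of level k+1 exceeds the new h(D), so that this run is long
   enough to reach the next threshold. *)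
Lemma returns_step k n : (threshold k <= n <= threshold k.+1)%N -> returns k n.
Proof.
move=> /andP[nge nle].
have [||w [p [q wE]] wn] := return_words (heights_coprime adm k) _
    (exponent1_ge adm k) (exponent2_ge adm k) (t := n) (M := (mn k.+1).1).
- by move=> c; apply: leq_ltn_trans (heights_ge k c).
- rewrite nge (leq_trans nle) // /threshold -(heightsS adm).
  rewrite mulnC (leq_trans _ (leq_addl _ _)) // leq_mul2r.
  by have := exponent1_ge adm k.+1; lia.
have [x px] := base_inhabited k.+2 B.
have := induces_follows (induces_step k.+1) px.
have -> : block k.+1 B =
    [:: A] ++ (nseq (mn k.+1).1.+1 B ++ [:: D]) ++ nseq (mn k.+1).2 D.
  by rewrite -catA.
move=> /follows_cat[x1 _ /follows_cat[x2 f2 _]].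
have := follows_substw (induces_step k) f2.
rewrite -/(block k) in wE; rewrite wE cat_rcons.
move=> /follows_cat[y0 _ /follows_cat[y1 f3 [py _]]].
exists y0, y1, (substw (tower_word k) w); split.
- by case: w f3 {wE wn} => [/= ->|c w /= [pc _]]; [exists D|exists c].
- by exists D.
- exact: follows_substw (induces_tower k) f3.
- by rewrite size_tower.
Qed.

Lemma returns_le k K n : (k <= K)%N -> returns K n -> returns k n.
Proof.
move=> kK [x [y [w [bx by_ f sw]]]].
by exists x, y, w; split=> //; apply: base_le kK _.
Qed.

(** The intervals of return times given by [returns_step] at levels k, k+1, ...
   are adjacent, and returns to a deeper base are returns to base k. *)
Lemma returns_ge k n : (threshold k <= n)%N -> returns k n.
Proof.
move=> nge.
have : (n <= threshold (k + n))%N.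
  rewrite /threshold; have := (heights_ge (k + n) B, heights_ge (k + n) D).
  by case; nia.
move: {2}n => j; elim: j k nge => [|j IH] k nge; rewrite ?addn0 => nle.
  have e : n = threshold k by apply/eqP; rewrite eqn_leq nle.
  apply: returns_step; rewrite nge e.
  rewrite /threshold leq_mul // (heightsS adm).
    by rewrite weight_block_wordB mulSn; lia.
  by rewrite weight_block_wordD mulSn; lia.
have [nk|nk] := leqP n (threshold k.+1).
  by apply: returns_step; rewrite nge.
apply: returns_le (leqnSn k) _; apply: IH; first exact: ltnW.
by rewrite addSnnS.
Qed.

Lemma block_wordD_letters m n c : (0 < m)%N ->
  exists p q, block_word m n D = p ++ c :: q.
Proof.
case: m => // m _; case: c.
- exists [::], (nseq m.+1 B ++ nseq n.+1 D ++ [:: A, C & nseq n.+1 D]).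
  by rewrite /= -catA.
- exists [:: A], (nseq m B ++ nseq n.+1 D ++ [:: A, C & nseq n.+1 D]).
  by rewrite /= -catA.
- exists ((A :: nseq m.+1 B ++ nseq n.+1 D) ++ [:: A]), (nseq n.+1 D).
  by rewrite -catA.
- exists (A :: nseq m.+1 B), (nseq n D ++ [:: A, C & nseq n.+1 D]).
  by rewrite /= -catA.
Qed.

(** Every point of base k+3 is in the piece A of level k+2, hence passes through
   the piece D of level k+1 after a fixed itinerary; and D' contains all four
   letters. *)
Lemma base_visits_pieces k c : exists w, forall x, base k.+3 x ->
  exists2 y, in_piece (S k) c y & follows (S k) w x y.
Proof.
have [p [q pq]] := block_wordD_letters (mn k).2 c (exponent1_gt0 k).
exists (substw (block k) (A :: nseq (mn k.+1).1 B) ++ p) => x /base_A px.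
have := induces_follows (induces_step k.+1) px.
have -> : block k.+1 A =
    (A :: nseq (mn k.+1).1 B) ++ D :: nseq (mn k.+1).2 D by [].
move=> /follows_cat[y f [py _]].
have := induces_follows (induces_step k) py.
rewrite {1}/block pq => /follows_cat[z f' [pz _]].
exists z => //; apply/follows_cat; exists y => //.
exact: follows_substw (induces_step k) f.
Qed.

Lemma pieces_cover x : 0 <= x < 1 -> exists c, in_piece (S 0) c x.
Proof.
move=> /andP[x0 x1]; have := total1; rewrite /total_width => t1.
have [xA|xA] := ltP x (v 0%N A).
  by exists A; split=> /=; lra.
have [xD|xD] := ltP x (v 0%N A + v 0%N D).
  by exists D; split=> /=; lra.
have [xB|xB] := ltP x (v 0%N A + v 0%N D + v 0%N B).
  by exists B; split=> /=; lra.
by exists C; split=> /=; lra.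
Qed.

(** The point y lies on a floor of the tower over some piece c of level k; this
   floor is a translate of c, so it is shorter than e once k is large. Points
   of base k+3 reach c by a fixed itinerary, and then this floor by another. *)
Lemma dense_orbits y e : 0 <= y < 1 -> 0 < e -> exists K w,
  forall x, base K x -> exists2 z, follows (S 0) w x z & `|y - z| < e.
Proof.
move=> /pieces_cover[c0 py] e0.
have [k ke] : exists k, k.+1%:R^-1 < e.
  exists (Num.trunc e^-1); rewrite invf_plt ?posrE //.
  exact: truncnS_gt.
have [c [x0 [u [u' [px0 uE fu]]]]] := induces_cover (induces_tower k) py.
have [w wP] := base_visits_pieces k c.
exists k.+3, (substw (tower_word k) w ++ u) => x /wP[x1 px1 f1].
have := induces_follows (induces_tower k) px1.
rewrite uE => /follows_cat[z fz _].
exists z.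
  apply/follows_cat; exists x1 => //.
  exact: follows_substw (induces_tower k) f1.
have := follows_translation fu fz => t.
have ws : width (S k) c < e := le_lt_trans (width_small k c) ke.
move: px0 px1 => [a0 b0] [a1 b1].
by rewrite ltr_norml; apply/andP; split; lra.
Qed.

End Renormalization.

(** * The exchange as a map of the unit interval *)

Section Map.
Variables (R : realType) (v : letter -> R).
Hypothesis v0 : forall c, 0 < v c.
Hypothesis total1 : total_width v = 1.

Let S := iet [:: A; D; B; C] [:: D; C; B; A] v.

Lemma piece_bounds c x : in_piece S c x -> 0 <= x < 1.
Proof.
move: total1 (v0 A) (v0 B) (v0 C) (v0 D); rewrite /total_width => ? ? ? ? ? [].
by case: c => /=; lra.
Qed.

Lemma iet_map_exists : exists T : unit_ico R -> unit_ico R,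
  forall x c, in_piece S c (val x) -> val (T x) = val x + shift S c.
Proof.
suff /choice[T TP] : forall x : unit_ico R, exists y : unit_ico R,
    forall c, in_piece S c (val x) -> val y = val x + shift S c by exists T.
move=> x.
have x01 : 0 <= val x < 1.
  by have := set_mem (valP x); rewrite /unit_ico /= in_itv.
have [c px] := pieces_cover (v := fun=> v) total1 x01.
have y01 : unit_ico R (val x + shift S c).
  rewrite /unit_ico /= in_itv /=; move: px total1 (v0 A) (v0 B) (v0 C) (v0 D).
  rewrite /total_width => -[]; case: c => /=; lra.
exists (SigSub (mem_set y01)) => d pd /=.
suff -> : c = d by [].
move: px pd (v0 A) (v0 B) (v0 C) (v0 D) => -[+ +] [].
by case: c {y01}; case: d => //= *; exfalso; lra.
Qed.

Lemma follows_iter (T : unit_ico R -> unit_ico R) w x y :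
  (forall x c, in_piece S c (val x) -> val (T x) = val x + shift S c) ->
  follows S w (val x) y -> val (iter (size w) T x) = y.
Proof.
move=> TP; elim: w x => [|c w IH] x //= [px fw].
by rewrite -iterS iterSr; apply: IH; rewrite (TP _ _ px).
Qed.

Definition letter_of (i : 'I_4) : letter := nth D [:: A; D; B; C] i.

(** The images come in the order D, C, B, A, and the letters are numbered in
   the order A, D, B, C. *)
Definition bottom_rank (i : 'I_4) : 'I_4 := inord (nth 0%N [:: 3; 0; 2; 1]%N i).

Lemma bottom_rankE i : bottom_rank i = nth 0%N [:: 3; 0; 2; 1]%N i :> nat.
Proof. by rewrite inordK //; case: i => [[|[|[|[|]]]] ?]. Qed.

Lemma bottom_rank_inj : injective bottom_rank.
Proof.
move=> i j /(congr1 (@nat_of_ord 4)); rewrite !bottom_rankE => e.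
apply: val_inj; case: i j e.
by case=> [|[|[|[|//]]]] ? [[|[|[|[|//]]]] ?].
Qed.

Lemma is_iet_of_map (T : unit_ico R -> unit_ico R) :
  (forall x c, in_piece S c (val x) -> val (T x) = val x + shift S c) ->
  is_iet 4 T.
Proof.
move=> TP; exists (v \o letter_of), (perm bottom_rank_inj); split.
  split=> [i|]; first exact: v0.
  by rewrite !big_ord_recr big_ord0 /= /letter_of /= -total1 /total_width; lra.
have startE (j : 'I_4) :
    \sum_(k < 4 | (k < j)%N) (v \o letter_of) k = left S (letter_of j).
  rewrite big_mkcond !big_ord_recr big_ord0 /= /letter_of /=.
  by case: j => [[|[|[|[|//]]]] ?] /=; ring.
have stopE (j : 'I_4) : \sum_(k < 4 | (k <= j)%N) (v \o letter_of) k =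
    left S (letter_of j) + width S (letter_of j).
  rewrite big_mkcond !big_ord_recr big_ord0 /= /letter_of /=.
  by case: j => [[|[|[|[|//]]]] ?] /=; ring.
have bottomE (j : 'I_4) :
    \sum_(k < 4 | (perm bottom_rank_inj k < perm bottom_rank_inj j)%N)
      (v \o letter_of) k = left S (letter_of j) + shift S (letter_of j).
  rewrite big_mkcond !big_ord_recr big_ord0 /= !permE !bottom_rankE.
  rewrite /letter_of /=.
  by case: j => [[|[|[|[|//]]]] ?] /=; ring.
move=> j x; rewrite /iet_piece /= in_itv /= startE stopE bottomE.
move=> /andP[lo hi].
by rewrite (TP _ (letter_of j)) // [RHS]addrA subrK.
Qed.

End Map.

Theorem theorem1 (R : realType) :
  exists T : unit_ico R -> unit_ico R,
    is_iet 4 T /\ topologically_mixing T.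
Proof.
have [mn [h adm]] := admissible_exist.
have [v [vE v0 t1]] := widths_exist R (exponent1_gt0 adm).
have [T TP] := iet_map_exists (v0 0%N) t1.
exists T; split; first exact: is_iet_of_map (v0 0%N) t1 T TP.
have mapE := follows_iter TP.
have dense (U : set (unit_ico R)) : open U -> U !=set0 ->
    exists K (w : seq letter),
    forall x, base v K (val x) -> U (iter (size w) T x).
  move=> /open_unit_ico[W oW ->] [y /= Wy].
  have /nbhs_ballP[e /= e0 eW] := open_nbhs_nbhs (conj oW Wy).
  have y01 : 0 <= val y < 1.
    by have := set_mem (valP y); rewrite /unit_ico /= in_itv.
  have [K [w wP]] := dense_orbits adm vE v0 t1 y01 e0.
  exists K, w => x /wP[z fz yz]; apply: eW.
  by rewrite (mapE _ _ _ fz).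
move=> U V oU oV /(dense _ oU)[K [u uP]] /(dense _ oV)[L [w wP]].
pose M := maxn K L.
exists (threshold h M + size w)%N => n nge.
have [|x [y [z [bx by_ fz sz]]]] := returns_ge adm vE v0 (k := M)
  (n := (n + size u - size w)%N); first by lia.
have x01 : unit_ico R x.
  have [c px] := base_le vE v0 (leq0n M) bx.
  by rewrite /unit_ico /= in_itv /=; apply: piece_bounds px.
pose X : unit_ico R := SigSub (mem_set x01).
exists (iter n T (iter (size u) T X)); split.
  exists (iter (size u) T X) => //.
  exact: uP X (base_le vE v0 (leq_maxl K L) bx).
rewrite -iterD (_ : (n + size u = size w + size z)%N); last by lia.
rewrite iterD; apply: wP; rewrite (mapE _ X _ fz).
by apply: (base_le vE v0 _ by_); exact: leq_maxr.
Qed.
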